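(* Let $\mathbf{u}$ be a Sturmian sequence over $\{a,b\}$ in which the frequency of $b$ is an irrational number $\alpha\in(0,1)$. Let $\mathbf{a}=1^\omega$ and let $\mathbf{b}$ be a Sturmian sequence over $\{2,3\}$ in which the frequency of the letter $3$ is $\gamma\in(0,1)$. Let $\mathbf{v}=\mathrm{colour}(\mathbf{u},\mathbf{a},\mathbf{b})$. Then: (i) $\mathbf{v}$ is $2$-balanced, and if $\alpha\notin\{\frac{1}{1+\gamma},\frac{1}{2-\gamma}\}$ then $\mathbf{v}$ is not $1$-balanced; (ii) for every integer $n\ge1$, $$\mathcal C_{\mathbf{v}}(n)\le P_\alpha(n)+(n+1)\lceil n\alpha\rceil\qquad\text{and}\qquad \mathcal C^{ab}_{\mathbf{v}}(n)\le 4.$$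
   Context: A sequence is $C$-balanced ($C\ge1$ an integer) if for any two of its factors $u,v$ with $|u|=|v|$ and every letter $x$, $\bigl||u|_x-|v|_x\bigr|\le C$, where $|w|_x$ counts occurrences of $x$ in $w$. A Sturmian sequence is an aperiodic (not eventually periodic) $1$-balanced sequence over a two-letter alphabet; letter frequencies in it exist and are irrational. Colouring: given $\mathbf{u}$ over $\{a,b\}$ and sequences $\mathbf{a},\mathbf{b}$ over disjoint alphabets, $\mathrm{colour}(\mathbf{u},\mathbf{a},\mathbf{b})$ is obtained from $\mathbf{u}$ by replacing the subsequence of all occurrences of $a$ (in order) by $\mathbf{a}$ and the subsequence of all occurrences of $b$ (in order) by $\mathbf{b}$. The factor complexity $\mathcal C_{\mathbf{v}}(n)$ is the number of distinct factors of length $n$ of $\mathbf{v}$; the abelian complexity $\mathcal C^{ab}_{\mathbf{v}}(n)$ is the number of distinct Parikh vectors $\Psi(w)$ (vector of letter counts) of factors $w$ of length $n$. For irrational $\alpha\in(0,1)$, $P_\alpha(n)$ denotes the number of factors $u$ of length $n$ of a Sturmian sequence over $\{a,b\}$ with frequency of $b$ equal to $\alpha$ such that $(|u|_a,|u|_b)=(\lfloor(1-\alpha)n\rfloor,\lceil n\alpha\rceil)$ (this depends only on $\alpha$). *)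

(* Defs.v *)
From HB Require Import structures.
From mathcomp Require Import all_boot all_order all_algebra.
From mathcomp Require Import all_classical all_reals all_analysis.
Set Implicit Arguments. Unset Strict Implicit. Unset Printing Implicit Defensive.
Import Order.TTheory GRing.Theory Num.Theory.
Import numFieldNormedType.Exports.
Local Open Scope classical_set_scope.
Local Open Scope ring_scope.

Definition factor {T : Type} (u : nat -> T) (i n : nat) : seq T :=
  mkseq (fun k => u (i + k)%N) n.

Definition is_factor {T : Type} (u : nat -> T) (w : seq T) : Prop :=
  exists i, w = factor u i (size w).

Definition balanced {T : eqType} (C : nat) (u : nat -> T) : Prop :=
  forall (i j n : nat) (x : T),
    (count_mem x (factor u i n) <= count_mem x (factor u j n) + C)%N.

Definition eventually_periodic {T : Type} (u : nat -> T) : Prop :=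
  exists p N : nat, (0 < p)%N /\ forall k, (N <= k)%N -> u (k + p)%N = u k.

Definition Sturmian {T : eqType} (x y : T) (u : nat -> T) : Prop :=
  x != y /\ (forall k, u k = x \/ u k = y) /\ balanced 1 u /\ ~ eventually_periodic u.

Definition frequency {R : realType} {T : eqType} (u : nat -> T) (x : T) (f : R) : Prop :=
  (fun n : nat => (count_mem x (factor u 0 n))%:R / n%:R : R) @ \oo --> f.


(* colour(u, a, b), where u is over {a,b} encoded as bool: false = a, true = b.
   Position n with u n = b receives b_k, k = number of b's before position n;
   similarly for a. *)
Definition colour {T : Type} (u : nat -> bool) (a b : nat -> T) : nat -> T :=
  fun n => if u n then b (count_mem true (factor u 0 n))
           else a (count_mem false (factor u 0 n)).

Definition parikh {T : eqType} (A : seq T) (w : seq T) : seq nat :=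
  [seq count_mem x w | x <- A].

Definition has_at_most {T : eqType} (S : T -> Prop) (K : int) : Prop :=
  forall L : seq T, uniq L -> (forall t, t \in L -> S t) -> (size L)%:Z <= K.

(* P_alpha(n), computed for the given Sturmian u over {a,b} (false = a,
   true = b) whose frequency of b is alpha *)
Definition P_alpha {R : realType} (u : nat -> bool) (alpha : R) (n : nat) : nat :=
  #|[set w : n.-tuple bool |
      `[< is_factor u (w : seq bool)
          /\ (count_mem false (w : seq bool))%:Z = Num.floor ((1 - alpha) * n%:R)
          /\ (count_mem true (w : seq bool))%:Z = Num.ceil (n%:R * alpha) >] ]|.

(* Main.v *)
(* Write w_i for the number of b's among the first i letters of u.  A factor of v of
   length n at position i is determined by the factor of u there and by the factor of
   the second sequence at position w_i, whose length m is the number of b's of the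
   former.  Balance of u leaves two consecutive values for m, and for each of them
   balance of the second sequence leaves two values for the number of 3's; this gives
   2-balance and the bound 4.  A balanced binary sequence has at most n + 1 factors of
   length n, since it has at most one left special factor of each length; summing
   m + 1 over the factors of u gives the bound on the factor complexity.

   The letters 1, 2, 3 of v have frequencies 1 - alpha, alpha (1 - gamma) and
   alpha gamma; the two excluded values of alpha are those for which the first one
   equals another one, and the last two differ because gamma is irrational.  A
   1-balanced ternary sequence whose letter frequencies are positive and pairwise
   distinct is eventually a shift of (abacaba)^omega, with a, b, c in decreasing order
   of frequency; so v would be eventually periodic, and u as well. *)
Require Import Defs.
From HB Require Import structures.
From mathcomp Require Import all_boot all_order all_algebra.
From mathcomp Require Import all_classical all_reals all_analysis.
From mathcomp Require Import zify lra.
(* Imported again because MathComp-Analysis shadows [factor]. *)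
Require Import Defs.
Import Order.TTheory GRing.Theory Num.Theory.
Local Open Scope ring_scope.
Set Implicit Arguments. Unset Strict Implicit. Unset Printing Implicit Defensive.

(** * Counting occurrences of a letter in windows *)

Definition occ {T : eqType} (v : nat -> T) (x : T) (i n : nat) : nat :=
  count_mem x (factor v i n).

Lemma size_factor T (v : nat -> T) i n : size (factor v i n) = n.
Proof. exact: size_mkseq. Qed.

Lemma factorD T (v : nat -> T) i n m :
  factor v i (n + m) = factor v i n ++ factor v (i + n) m.
Proof.
rewrite /factor /mkseq iotaD map_cat add0n; congr (_ ++ _).
rewrite -[n in iota n m]addn0 iotaDl -map_comp.
by apply: eq_map => k /=; rewrite addnA.
Qed.

Lemma factorSl T (v : nat -> T) i n : factor v i n.+1 = v i :: factor v i.+1 n.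
Proof. by rewrite -add1n factorD addn1 /= addn0. Qed.

Lemma factorSr T (v : nat -> T) i n : factor v i n.+1 = rcons (factor v i n) (v (i + n)%N).
Proof. by rewrite -addn1 factorD cats1 addn0. Qed.

Lemma occD (T : eqType) (v : nat -> T) x i n m :
  occ v x i (n + m) = (occ v x i n + occ v x (i + n) m)%N.
Proof. by rewrite /occ factorD count_cat. Qed.

Lemma occ0 (T : eqType) (v : nat -> T) x i : occ v x i 0 = 0%N.
Proof. by []. Qed.

Lemma occS (T : eqType) (v : nat -> T) x i n :
  occ v x i n.+1 = (occ v x i n + (v (i + n)%N == x))%N.
Proof. by rewrite /occ factorSr -cats1 count_cat /= addn0. Qed.

Lemma occSl (T : eqType) (v : nat -> T) x i n :
  occ v x i n.+1 = ((v i == x) + occ v x i.+1 n)%N.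
Proof. by rewrite /occ factorSl. Qed.

Lemma occ_le_size (T : eqType) (v : nat -> T) x i n : (occ v x i n <= n)%N.
Proof. by rewrite -[leqRHS](size_factor v i) count_size. Qed.

Lemma occ_blocks_le (T : eqType) (v : nat -> T) x n m :
  (forall i, occ v x i n <= m)%N -> forall k i, (occ v x i (k * n) <= k * m)%N.
Proof.
move=> H; elim=> [|k IH] i; first by rewrite !mul0n occ0.
by rewrite !mulSn occD leq_add.
Qed.

Lemma occ_blocks_ge (T : eqType) (v : nat -> T) x n m :
  (forall i, m <= occ v x i n)%N -> forall k i, (k * m <= occ v x i (k * n))%N.
Proof.
move=> H; elim=> [|k IH] i; first by rewrite !mul0n occ0.
by rewrite !mulSn occD leq_add.
Qed.

(** * Letter frequencies and discrepancy *)

Lemma frequency_approx (R : realType) (T : eqType) (v : nat -> T) x (f : R) :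
  frequency v x f -> forall e : R, 0 < e ->
  exists N, forall n, (N <= n)%N -> `|(occ v x 0 n)%:R - n%:R * f| <= e * n%:R.
Proof.
move=> /cvgrPdist_le H e e0.
have [N _ HN] := H e e0.
(* The successor keeps [n] positive, so that the division by [n] can be undone. *)
exists N.+1 => n Nn.
have n0 : 0 < n%:R :> R by rewrite ltr0n; lia.
have := HN n (ltnW Nn).
rewrite -/(occ v x 0 n) distrC => {}HN.
have -> : (occ v x 0 n)%:R - n%:R * f = ((occ v x 0 n)%:R / n%:R - f) * n%:R.
  by rewrite mulrBl divfK ?gt_eqF // [f * _]mulrC.
by rewrite normrM (gtr0_norm n0) ler_wpM2r // ltW.
Qed.

Lemma discrepancy_frequency (R : realType) (T : eqType) (v : nat -> T) x (f C : R) :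
  (forall n, `|(occ v x 0 n)%:R - n%:R * f| <= C) -> frequency v x f.
Proof.
move=> H; apply/cvgrPdist_le => e e0.
have C0 : 0 <= C by apply: le_trans (H 0%N).
exists (Num.bound (C / e)).+1 => // n /= Nn.
have n0 : 0 < n%:R :> R by rewrite ltr0n; lia.
rewrite -/(occ v x 0 n) distrC.
rewrite -(ler_pM2r n0) -[X in _ * X <= _](gtr0_norm n0) -normrM.
rewrite mulrBl divfK ?gt_eqF // [f * _]mulrC.
apply: le_trans (H n) _.
have := archi_boundP (divr_ge0 C0 (ltW e0)).
rewrite ltr_pdivrMr // => /ltW/le_trans; apply.
by rewrite mulrC ler_wpM2l ?(ltW e0) // ler_nat (leq_trans _ Nn).
Qed.

(** A prefix of length [k * n] splits into [k] windows with at most [m] occurrences each; dividing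
    by [k] and letting it grow bounds the mean. *)
Lemma frequency_le (R : realType) (T : eqType) (v : nat -> T) x (f : R) n m :
  frequency v x f -> (forall i, occ v x i n <= m)%N -> n%:R * f <= m%:R.
Proof.
move=> Hf H; case: n H => [|n] H; first by rewrite mul0r.
apply/ler_addgt0Pr => e e0.
have n0 : 0 < n.+1%:R :> R by rewrite ltr0n.
have [N HN] := frequency_approx Hf (divr_gt0 e0 n0).
have k0 : 0 < N.+1%:R :> R by rewrite ltr0n.
have := occ_blocks_le H N.+1 0%N; rewrite -(ler_nat R).
have /ler_normlP[+ _] := HN (N.+1 * n.+1)%N ltac:(nia).
have -> : e / n.+1%:R * (N.+1 * n.+1)%:R = e * N.+1%:R.
  by rewrite natrM [N.+1%:R * _]mulrC mulrA divfK ?gt_eqF.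
rewrite !natrM => h1 h2; rewrite -(ler_pM2l k0); lra.
Qed.

Lemma frequency_ge (R : realType) (T : eqType) (v : nat -> T) x (f : R) n m :
  frequency v x f -> (forall i, m <= occ v x i n)%N -> m%:R <= n%:R * f.
Proof.
move=> Hf H; case: n H => [|n] H.
  by rewrite mul0r (_ : m = 0%N) //; have := H 0%N; rewrite occ0; lia.
apply/ler_addgt0Pr => e e0.
have n0 : 0 < n.+1%:R :> R by rewrite ltr0n.
have [N HN] := frequency_approx Hf (divr_gt0 e0 n0).
have k0 : 0 < N.+1%:R :> R by rewrite ltr0n.
have := occ_blocks_ge H N.+1 0%N; rewrite -(ler_nat R).
have /ler_normlP[_ +] := HN (N.+1 * n.+1)%N ltac:(nia).
have -> : e / n.+1%:R * (N.+1 * n.+1)%:R = e * N.+1%:R.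
  by rewrite natrM [N.+1%:R * _]mulrC mulrA divfK ?gt_eqF.
rewrite !natrM => h1 h2; rewrite -(ler_pM2l k0); lra.
Qed.

(** By balance, the count in one window differs by at most 1 from that in any other window of length
    [n]; the mean [n * f] of these counts inherits both bounds. *)
Lemma balanced_discrepancy (R : realType) (T : eqType) (v : nat -> T) x (f : R) i n :
  balanced 1 v -> frequency v x f -> `|(occ v x i n)%:R - n%:R * f| <= 1.
Proof.
move=> bal Hf; apply/ler_normlP; split.
  have := @frequency_le _ _ _ _ _ n (occ v x i n + 1) Hf (fun j => bal j i n x).
  by rewrite natrD; lra.
have := @frequency_ge _ _ _ _ _ n (occ v x i n - 1) Hf.
have [->|n0] := posnP (occ v x i n).
  by move=> /(_ (fun j => leq0n _)); rewrite sub0n; lra.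
rewrite natrB // => /(_ _)/wrap[|]; last lra.
by move=> j; have := bal i j n x; rewrite -!/(occ _ _ _ _); lia.
Qed.

Lemma frequency_compare (R : realType) (T : eqType) (v : nat -> T) x y (f g : R) :
  frequency v x f -> frequency v y g ->
  (forall n, occ v x 0 n <= (occ v y 0 n).+1)%N -> f <= g.
Proof.
move=> Hf Hg H; apply/ler_addgt0Pr => e e0.
have e3 : 0 < e / 3 by lra.
have [N HN] := frequency_approx Hf e3.
have [M HM] := frequency_approx Hg e3.
(* This [K] gives [1 <= e * n / 3]: the additive 1 and the two approximation errors cost [e * n / 3]
   each. *)
pose K := Num.bound (3 / e); pose n := (N + M + K).+1.
have := archi_boundP (ltW (divr_gt0 (ltr0n R 3) e0)); rewrite -/K ltr_pdivrMr // => HK.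
have /ler_normlP[h1 _] := HN n ltac:(rewrite /n; lia).
have /ler_normlP[_ h2] := HM n ltac:(rewrite /n; lia).
have := H n; rewrite -(ler_nat R) -addn1 natrD => h3.
have Kn : K%:R <= n%:R :> R by rewrite ler_nat /n; lia.
have n0 : 0 < n%:R :> R by rewrite ltr0n.
rewrite -(ler_pM2l n0).
nra.
Qed.

(** * Rational frequency forces eventual periodicity *)

Lemma occ_blocks_lt (T : eqType) (v : nat -> T) x n m i k :
  (forall j, occ v x j n <= m)%N ->
  (occ v x i n < m -> occ v x (i + k.+1 * n) n < m ->
   (occ v x i (k.+2 * n)).+2 <= k.+2 * m)%N.
Proof.
move=> H h1 h2.
have -> : (k.+2 * n = n + (k * n + n))%N by rewrite !mulSn; lia.
rewrite !occD -addnA -mulSn.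
have := occ_blocks_le H k (i + n)%N; nia.
Qed.

Lemma occ_blocks_gt (T : eqType) (v : nat -> T) x n m i k :
  (forall j, m <= occ v x j n)%N ->
  (m < occ v x i n -> m < occ v x (i + k.+1 * n) n ->
   (k.+2 * m).+2 <= occ v x i (k.+2 * n))%N.
Proof.
move=> H h1 h2.
have -> : (k.+2 * n = n + (k * n + n))%N by rewrite !mulSn; lia.
rewrite !occD -addnA -mulSn.
have := occ_blocks_ge H k (i + n)%N; nia.
Qed.

(** Each residue class modulo [n] contains at most one position satisfying [P]; the maximum over the
    [n] classes bounds them all. *)
Lemma finitely_many_mod (P : nat -> Prop) (n : nat) : (0 < n)%N ->
  (forall i k, P i -> ~ P (i + k.+1 * n)%N) ->
  exists N, forall i, (N <= i)%N -> ~ P i.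
Proof.
move=> n0 H.
have [N HN] : exists N : nat, forall r : 'I_n, forall i,
    (N <= i)%N -> (i %% n)%N = r -> ~ P i.
  have Hr (r : 'I_n) : exists N, forall i, (N <= i)%N -> (i %% n)%N = r -> ~ P i.
    have [[i [ir Pi]]|noP] := pselect (exists i, (i %% n)%N = r /\ P i); last first.
      by exists 0%N => i _ ir Pi; apply: noP; exists i.
    exists i.+1 => j ij jr; have := H i ((j %/ n - i %/ n).-1)%N Pi.
    suff <- : j = (i + ((j %/ n - i %/ n).-1).+1 * n)%N by [].
    have := divn_eq i n; have := divn_eq j n; rewrite ir jr.
    move: (i %/ n)%N (j %/ n)%N => qi qj ej ei.
    have qij : (qi < qj)%N by nia.
    by rewrite prednK ?subn_gt0 // mulnBl; nia.
  have [N HN] := choice Hr.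
  exists (\max_(r < n) N r)%N => r i Ni; apply: HN.
  exact: leq_trans (leq_bigmax _) Ni.
exists N => i Ni; have ir := ltn_pmod i n0.
exact: (HN (Ordinal ir)).
Qed.

(** Sliding the window by one position drops the letter at [i] and gains the one at [i + n]. *)
Lemma occ_eq_shift (T : eqType) (v : nat -> T) x i n :
  occ v x i n = occ v x i.+1 n -> (v (i + n)%N == x) = (v i == x).
Proof. by have := occS v x i n; rewrite occSl => h1 h2; move: h1; rewrite h2; do 2 case: eqP => //; lia. Qed.

(* A window of length n with n f occurrences of x is typical; balance forces the
   atypical windows to deviate all in the same direction, and two of them at
   distance a multiple of n already exceed the discrepancy 1. *)
Lemma balanced_rational_eventually (R : realType) (T : eqType) (v : nat -> T) x
    (f : R) n m :
  balanced 1 v -> frequency v x f -> (0 < n)%N -> n%:R * f = m%:R ->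
  exists N, forall i, (N <= i)%N -> (v (i + n)%N == x) = (v i == x).
Proof.
move=> bal Hf n0 nf.
have disc k i : (k * m <= (occ v x i (k * n)).+1 /\ occ v x i (k * n) <= (k * m).+1)%N.
  have /ler_normlP[h1 h2] := balanced_discrepancy i (k * n) bal Hf.
  rewrite natrM -mulrA nf -natrM in h1 h2.
  by rewrite -!(ler_nat R) -!natr1; split; lra.
suff [N HN] : exists N, forall i, (N <= i)%N -> ~ (occ v x i n != m).
  exists N => i Ni; apply: occ_eq_shift.
  have /negP := HN _ Ni; have /negP := HN _ (leqW Ni); rewrite !negbK.
  by move=> /eqP-> /eqP->.
have [le|/existsNP[i0 /negP lt]] := pselect (forall i, (occ v x i n <= m)%N).
  apply: (@finitely_many_mod _ n n0) => i k h1 h2.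
  have := @occ_blocks_lt _ v x n m i k le; have := disc k.+2 i.
  have := le i; have := le (i + k.+1 * n)%N; lia.
have ge i : (m <= occ v x i n)%N.
  by have := bal i0 i n x; rewrite -!/(occ _ _ _ _); lia.
apply: (@finitely_many_mod _ n n0) => i k h1 h2.
have := @occ_blocks_gt _ v x n m i k ge; have := disc k.+2 i.
have := ge i; have := ge (i + k.+1 * n)%N; lia.
Qed.

(** * Occurrences extracted from frequencies *)

Lemma occ_ge2_witness (T : eqType) (v : nat -> T) x y :
  (exists n, (occ v y 0 n).+1 < occ v x 0 n)%N ->
  exists i j, [/\ (i < j)%N, v i = x, v j = x & forall k, (i < k < j)%N -> v k <> y].
Proof.
move=> [n Hn]; apply: contrapT => H.
(* If a y separated any two x's, the x's would never lead by more than one; when they lead by one,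
   no y has occurred since some x at [j]. *)
suff : forall n, (occ v x 0 n <= occ v y 0 n)%N \/
   (occ v x 0 n = (occ v y 0 n).+1 /\
    exists2 j, (j < n)%N /\ v j = x & forall k, (j < k < n)%N -> v k <> y).
  by move=> /(_ n); lia.
elim=> [|{Hn}n [IH|[IH [j [jn vj] Hj]]]]; first by left.
  - rewrite !occS add0n; case: (v n =P x) => vx; case: (v n =P y) => vy; try (left; lia).
    have [->|lt] : occ v x 0 n = occ v y 0 n \/ (occ v x 0 n < occ v y 0 n)%N by lia.
      by right; split; [lia|exists n => // k; lia].
    by left; lia.
  - rewrite !occS add0n; case: (v n =P y) => vy.
      left; case: (v n =P x) => [vx|]; last by lia.
      by move: IH; rewrite -vx vy; lia.
    have [vx|vx] := v n =P x.
      by exfalso; apply: H; exists j, n.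
    right; split; first by lia.
    exists j; first by split=> //; lia.
    move=> k jk; have [->//|kn] := eqVneq k n.
    by apply: Hj; lia.
Qed.

Lemma frequency_lt_witness (R : realType) (T : eqType) (v : nat -> T) x y (f g : R) :
  frequency v x f -> frequency v y g -> g < f ->
  exists i j, [/\ (i < j)%N, v i = x, v j = x & forall k, (i < k < j)%N -> v k <> y].
Proof.
move=> Hf Hg gf; apply: occ_ge2_witness; apply: contrapT => H.
suff : f <= g by rewrite leNgt gf.
apply: (frequency_compare Hf Hg) => n; rewrite leqNgt; apply/negP => lt.
by apply: H; exists n.
Qed.

Lemma frequency_pos_infinitely (R : realType) (T : eqType) (v : nat -> T) x (f : R) :
  frequency v x f -> 0 < f -> forall N, exists2 i, (N <= i)%N & v i = x.
Proof.
move=> Hf f0 N; apply: contrapT => H.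
have bnd n : (occ v x 0 n <= N)%N.
  elim: n => [//|n IH]; have [nN|Nn] := leqP n.+1 N.
    exact: leq_trans (occ_le_size v x 0 n.+1) nN.
  rewrite occS add0n; case: (v n =P x) => [vn|]; last by rewrite addn0.
  by exfalso; apply: H; exists n.
have [M HM] := frequency_approx Hf (divr_gt0 f0 (ltr0n R 2)).
(* Chosen so that [K * f / 2] exceeds [N + 1], whereas at most [N] occurrences are available. *)
pose K := Num.bound (N.+1%:R * 2 / f).
have := archi_boundP (ltW (divr_gt0 (mulr_gt0 (ltr0n R N.+1) (ltr0n R 2)) f0)); rewrite -/K ltr_pdivrMr // => HK.
have /ler_normlP[+ _] := HM (M + K)%N (leq_addr _ _).
have := bnd (M + K)%N; rewrite -(ler_nat R) natrD.
have M0 : 0 <= M%:R :> R by rewrite ler0n.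
rewrite -natr1 in HK; nra.
Qed.


(** * Ternary 1-balanced sequences with distinct frequencies *)

Lemma balanced_window (T : eqType) (v : nat -> T) x i j n :
  balanced 1 v -> (1 < occ v x i n)%N -> (0 < occ v x j n)%N.
Proof. by move=> bal; have := bal i j n x; rewrite -!/(occ _ _ _ _); lia. Qed.

(** After a c the forbidden factors force a, b, a, a, b, a and then c again, and a c cannot be
    postponed. *)
Lemma abacaba_periodic (T : eqType) (w : nat -> T) a b c :
  a <> b -> a <> c -> (forall k, [\/ w k = a, w k = b | w k = c]) ->
  (forall k, w k = a \/ w k.+1 = a) ->
  (forall k, w k = a -> w k.+1 = a -> w k.+2 = a -> False) ->
  (forall k, w k = b -> w k.+1 = a -> w k.+2 = b -> False) ->
  (forall k, w k = c -> w k.+1 = a -> w k.+2 = c -> False) ->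
  (forall k, w k = c -> w k.+1 = a -> w k.+2 = a -> False) ->
  (forall k, w k = a -> w k.+1 = a -> w k.+2 = c -> False) ->
  (forall k, w k = a -> w k.+1 = a -> w k.+2 = b -> w k.+3 = a -> w k.+4 = a -> False) ->
  (forall k, w k = c -> w k.+1 = a -> w k.+2 = b -> w k.+3 = a -> w k.+4 = c -> False) ->
  forall k, w (k + 7)%N = w k.
Proof.
move=> ab ac tri Na aaa bab cac caa aac aabaa cabac.
have bb k : w k = b -> w k.+1 = b -> False by case: (Na k) => ->; auto.
have bc k : w k = b -> w k.+1 = c -> False by case: (Na k) => ->; auto.
have cb k : w k = c -> w k.+1 = b -> False by case: (Na k) => ->; auto.
have cc k : w k = c -> w k.+1 = c -> False by case: (Na k) => ->; auto.
move=> k; rewrite !addnS addn0.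
(* The letters at [k] to [k + 7] are enumerated; in each admissible word the first and the last
   agree. *)
case: (tri k) => E0; case: (tri k.+1) => E1; try by exfalso; eauto 3.
all: case: (tri k.+2) => E2; try by exfalso; eauto 4.
all: case: (tri k.+3) => E3; try by exfalso; eauto 4.
all: case: (tri k.+4) => E4; try by exfalso; eauto 6.
all: case: (tri k.+4.+1) => E5; try by exfalso; eauto 6.
all: case: (tri k.+4.+2) => E6; try by exfalso; eauto 6.
all: case: (tri k.+4.+3) => E7; try by exfalso; eauto 6.
all: congruence.
Qed.

(** Two x's in one window of length [k.+2] put an x into every such window, whence a frequency of at
    least [1 / k.+2]. *)
Lemma balanced_no_double (R : realType) (T : eqType) (v : nat -> T) x (f : R) k n :
  balanced 1 v -> frequency v x f -> k.+2%:R * f < 1 ->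
  v n = x -> v (n + k.+1)%N = x -> False.
Proof.
move=> bal Hf f1 h1 h2.
have h i : (1 <= occ v x i k.+2)%N.
  apply: (@balanced_window _ v x n i) => //.
  rewrite occS occSl h1 h2 !eqxx; lia.
have := frequency_ge Hf h; lra.
Qed.

(** Without aa, the excess of b over c produces bab and the excess of a over b produces aca; the
    first has two b's and the second none. *)
Lemma balanced_ternary_no_aa (R : realType) (T : eqType) (v : nat -> T) a b c
    (fa fb fc : R) :
  a <> b -> b <> c -> a <> c -> (forall k, [\/ v k = a, v k = b | v k = c]) ->
  balanced 1 v -> frequency v a fa -> frequency v b fb -> frequency v c fc ->
  fc < fb -> fb < fa -> fa + fb + fc = 1 -> 0 < fc ->
  (forall k, v k = a -> v k.+1 = a -> False) -> False.
Proof.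
move=> ab bc ac tri bal Ha Hb Hc cb ba sum c0 naa.
have nbb k : v k = b -> v k.+1 = b -> False.
  by rewrite -addn1; apply: (balanced_no_double bal Hb); lra.
have ncc k : v k = c -> v k.+1 = c -> False.
  by rewrite -addn1; apply: (balanced_no_double bal Hc); lra.
have [i bab] : exists i, [/\ v i = b, v i.+1 = a & v i.+2 = b].
  have [i [j [ij vi vj nc]]] := frequency_lt_witness Hb Hc cb.
  have jne : j <> i.+1 by move=> ?; subst j; exact: nbb vi vj.
  have vi1 : v i.+1 = a.
    case: (tri i.+1) => // [/(nbb _ vi)//|/nc []]; lia.
  exists i; split => //; case: (tri i.+2) => // [/(naa _ vi1)//|h].
  have [e|ne] := eqVneq j i.+2; first by rewrite -e.
  by exfalso; apply: (nc i.+2) => //; lia.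
have naca k : v k = a -> v k.+1 = c -> v k.+2 = a -> False.
  move=> h0 h1 h2.
  have : (0 < occ v b k 3)%N.
    apply: (@balanced_window _ v b i) => //; case: bab => g0 g1 g2.
    by rewrite !occSl occ0 g0 g1 g2 !eqxx; lia.
  by rewrite !occSl occ0 h0 h1 h2 !(introF eqP) //; congruence.
have [i' [j [ij vi vj nb]]] := frequency_lt_witness Ha Hb ba.
have jne : j <> i'.+1 by move=> ?; subst j; exact: naa vi vj.
have vi1 : v i'.+1 = c.
  case: (tri i'.+1) => // [/(naa _ vi)//|/nb []]; lia.
have [e|ne] := eqVneq j i'.+2; first by apply: (naca i') => //; rewrite -e.
case: (tri i'.+2) => [/(naca _ vi vi1)//|/nb[]|/(ncc _ vi1)//]; lia.
Qed.

(** The factor aa isolates b and c. Balance then forces baab to occur and every c with two letters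
    before it to sit inside bacab; comparison with these factors excludes all that
    [abacaba_periodic] forbids. *)
Lemma balanced_ternary_aa (R : realType) (T : eqType) (v : nat -> T) a b c
    (fa fb fc : R) :
  a <> b -> b <> c -> a <> c -> (forall k, [\/ v k = a, v k = b | v k = c]) ->
  balanced 1 v -> frequency v a fa -> frequency v b fb -> frequency v c fc ->
  fc < fb -> fb < fa -> fa + fb + fc = 1 -> 0 < fc ->
  (exists k, v k = a /\ v k.+1 = a) -> eventually_periodic v.
Proof.
move=> ab bc ac tri bal Ha Hb Hc cb ba sum c0 [i0 [aa0 aa1]].
have Na k : v k = a \/ v k.+1 = a.
  have : (0 < occ v a k 2)%N.
    by apply: (@balanced_window _ v a i0) => //; rewrite !occSl occ0 aa0 aa1 !eqxx.
  by rewrite !occSl occ0; do 2 case: eqP; auto.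
have Na' k : v k <> a -> v k.+1 = a by case: (Na k).
have ncac k : v k = c -> v k.+1 = a -> v k.+2 = c -> False.
  by move=> h _; rewrite -addn2; apply: (balanced_no_double bal Hc) h; lra.
(* A closest pair of b without c in between: the word b a^k b. *)
have [k [i [k0 vi vj vm]]] : exists k i, [/\ (0 < k)%N, v i = b, v (i + k.+1)%N = b &
    forall m, (m < k)%N -> v (i + m.+1)%N = a].
  have ex : exists d, `[< exists i, [/\ v i = b, v (i + d.+1)%N = b &
      forall m, (m < d)%N -> v (i + m.+1)%N <> c] >].
    have [i [j [ij vi vj nc]]] := frequency_lt_witness Hb Hc cb.
    exists (j - i).-1; apply/asboolP; exists i; split => //.
      by rewrite prednK ?subn_gt0 // subnKC // ltnW.
    by move=> m mk; apply: nc; lia.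
  case: (ex_minnP ex) => k /asboolP[i [vi vj nc]] kmin; exists k, i; split=> //.
    case: (k) vj => // vj; have := Na' i; rewrite vi -addn1 vj; intuition congruence.
  move=> m mk; case: (tri (i + m.+1)%N) => // [vb|/nc//].
  have : (k <= m)%N; last by lia.
  apply: kmin; apply/asboolP; exists i; split => // m' m'm; apply: nc; lia.
(* The word b a^k b has two b's, so every window of its length has one. *)
have wb j : (0 < occ v b j k.+2)%N.
  apply: (@balanced_window _ v b i) => //.
  by rewrite occS occSl vi vj !eqxx; lia.
have nb j : (forall m, (m < k.+2)%N -> v (j + m)%N <> b) -> False.
  move=> H; have := wb j; rewrite -has_count => /hasP[x].
  by move=> /mapP[m]; rewrite mem_iota add0n => /andP[_ /H] h -> /eqP.
(* As a^k occurs, a window of length [d.+1 <= k] misses at most one a. *)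
have far q d : (0 < d < k)%N -> v q <> a -> v (q + d)%N <> a -> False.
  move=> /andP[d0 dk] h1 h2.
  have full : occ v a i.+1 d.+1 = d.+1.
    have le m : (m <= k)%N -> occ v a i.+1 m = m.
      elim: m => [//|m IH mk]; by rewrite occS (IH (ltnW mk)) addSnnS vm // eqxx addn1.
    exact: le.
  have := bal i.+1 q d.+1 a; rewrite -!/(occ _ _ _ _) full.
  case: d d0 {dk full} h2 => // d _ h2.
  rewrite occSl occS addSnnS !(introF eqP) //.
  have := occ_le_size v a q.+1 d; lia.
have cN p : v p.+1 = c -> v p = a /\ v p.+2 = a.
  move=> vp; split; last by apply: Na'; congruence.
  by case: (Na p) => //; congruence.
have [q qk vq] := frequency_pos_infinitely Hc c0 2.
(* For [k = 1] the window aca around a c lacks b. For [k >= 3] the window of length [k.+2] starting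
   two letters before a c lacks b, since all its letters other than the c are within distance less
   than [k] of it. *)
have k2 : k = 2%N.
  have [k1|k3|//] := ltngtP k 2.
    case: q qk vq => // q _ vq; have [h1 h2] := cN _ vq; exfalso; apply: (@nb q) => -[|[|[|m]]] mk; try lia.
    - by rewrite addn0; congruence.
    - by rewrite addn1 vq; congruence.
    - by rewrite addn2; congruence.
  exfalso; apply: (@nb (q - 2)%N) => m mk vb.
  have [m2|m2|m2] := ltngtP m 2.
  - apply: (@far (q - 2 + m)%N (2 - m)%N); [lia|congruence|].
    by rewrite (_ : (_ + _)%N = q) ?vq; [congruence|lia].
  - apply: (@far q (m - 2)%N); [lia|congruence|].
    by rewrite (_ : (_ + _)%N = (q - 2 + m)%N) ?vb; [congruence|lia].
  - by move: vb; rewrite m2 subnK // vq; congruence.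
subst k; clear k0 far.
have vi1 : v i.+1 = a by rewrite -addn1 vm.
have vi2 : v i.+2 = a by rewrite -addn2 vm.
have vi3 : v i.+3 = b by rewrite -addn3.
have vi4 : v i.+4 = a by apply: Na'; congruence.
(* An a two places away from c would give aaca or acaa, a window of length 4 without b; a c there
   would give cac. *)
have ctx p : v p.+2 = c -> [/\ v p = b, v p.+1 = a, v p.+3 = a & v p.+4 = b].
  move=> vc; have [h1 h3] := cN _ vc; split=> //.
    case: (tri p) => // h; last by case: (ncac p).
    exfalso; apply: (@nb p) => -[|[|[|[|m]]]] //; rewrite ?addn0 ?addn1 ?addn2 ?addn3; congruence.
  case: (tri p.+4) => // h; last by case: (ncac p.+2).
  exfalso; apply: (@nb p.+1) => -[|[|[|[|m]]]] //; rewrite ?addn0 ?addn1 ?addn2 ?addn3; congruence.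
have {q qk vq} [q vq] : exists q, v q.+2 = c.
  by case: q qk vq => [|[|q]] // _ vq; exists q.
have [q0 q1 q3 q4] := ctx _ vq.
(* Periodicity is claimed from position 2 on because [ctx] needs two letters before the c. *)
exists 7%N, 2%N; split=> // n n2; rewrite -(subnK n2) addnAC.
have bF : (b == a) = false by apply/eqP; congruence.
have cF : (c == a) = false by apply/eqP; congruence.
have aF : (a == b) = false by apply/eqP; congruence.
have aC : (a == c) = false by apply/eqP; congruence.
have bC : (b == c) = false by apply/eqP; congruence.
have cB : (c == b) = false by apply/eqP; congruence.
apply: (@abacaba_periodic _ (fun k => v (k + 2)%N) a b c ab ac) => //= m;
  rewrite ?addSn ?addn2; try exact: tri.
(* Balance rules out aaa against bac, bab against aca, aabaa against bacab, and cabac against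
   baaba. *)
- move=> h0 h1 h2; have := bal m.+2 q 3 a; rewrite -!/(occ _ _ _ _).
  by rewrite !occSl !occ0 h0 h1 h2 q0 q1 vq !eqxx bF cF.
- move=> h0 h1 h2; have : (0 < occ v b q.+1 3)%N.
    apply: (@balanced_window _ v b m.+2) => //.
    by rewrite !occSl !occ0 h0 h1 h2 !eqxx aF.
  by rewrite !occSl !occ0 q1 q3 vq aF cB.
- exact: ncac.
- by move=> /ctx[_ _ _ ->] _; congruence.
- by move=> h0 h1 /ctx[]; congruence.
- move=> h0 h1 h2 h3 h4; have := bal m.+2 q 5 a; rewrite -!/(occ _ _ _ _).
  by rewrite !occSl !occ0 h0 h1 h2 h3 h4 q0 q1 vq q3 q4 !eqxx bF cF.
- move=> h0 h1 h2 h3 h4; have : (0 < occ v c i 5)%N.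
    apply: (@balanced_window _ v c m.+2) => //.
    by rewrite !occSl !occ0 h0 h1 h2 h3 h4 !eqxx; lia.
  by rewrite !occSl !occ0 vi vi1 vi2 vi3 vi4 aC bC.
Qed.

Lemma balanced_ternary (R : realType) (T : eqType) (v : nat -> T) a b c
    (fa fb fc : R) :
  a <> b -> b <> c -> a <> c -> (forall k, [\/ v k = a, v k = b | v k = c]) ->
  balanced 1 v -> frequency v a fa -> frequency v b fb -> frequency v c fc ->
  fc < fb -> fb < fa -> fa + fb + fc = 1 -> 0 < fc -> eventually_periodic v.
Proof.
move=> ab bc ac tri bal Ha Hb Hc cb ba sum c0.
have [H|H] := pselect (exists k, v k = a /\ v k.+1 = a).
  exact: (balanced_ternary_aa ab bc ac tri bal Ha Hb Hc cb ba sum c0 H).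
exfalso; apply: (balanced_ternary_no_aa ab bc ac tri bal Ha Hb Hc cb ba sum c0).
by move=> k h0 h1; apply: H; exists k.
Qed.

(** * Balance and letter frequencies of the colouring *)

Lemma occ_colour (T : eqType) (u : nat -> bool) (a0 : T) (b : nat -> T) x i n :
  x != a0 -> occ (colour u (fun=> a0) b) x i n =
             occ b x (occ u true 0 i) (occ u true i n).
Proof.
move=> xa; elim: n => [|n IH]; first by rewrite !occ0.
rewrite !occS IH /colour; case un: (u (i + n)%N) => /=.
  by rewrite addn1 occS -/(occ u true 0 _) occD.
by rewrite eq_sym (negbTE xa) !addn0.
Qed.

Lemma occ_colour_const (T : eqType) (u : nat -> bool) (a0 : T) (b : nat -> T) i n :
  (forall k, b k != a0) -> occ (colour u (fun=> a0) b) a0 i n = occ u false i n.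
Proof.
move=> ba; elim: n => [//|n IH].
rewrite !occS IH /colour; case: (u (i + n)%N) => /=; first by rewrite (negbTE (ba _)).
by rewrite eqxx.
Qed.

Lemma occ_false (u : nat -> bool) i n : (occ u false i n + occ u true i n)%N = n.
Proof. by elim: n => [//|n IH]; rewrite !occS; case: (u _) => /=; lia. Qed.

Lemma occ_two (T : eqType) (b : nat -> T) x y i n : x != y ->
  (forall k, b k = x \/ b k = y) -> (occ b x i n + occ b y i n)%N = n.
Proof.
move=> xy H; elim: n => [//|n IH]; rewrite !occS.
by case: (H (i + n)%N) => ->; rewrite eqxx ?[y == x]eq_sym (negbTE xy); lia.
Qed.

Lemma occ_mono (T : eqType) (v : nat -> T) x i n m :
  (n <= m)%N -> (occ v x i n <= occ v x i m <= occ v x i n + (m - n))%N.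
Proof.
move=> nm; have := occD v x i n (m - n); rewrite subnKC // => ->.
by rewrite leq_addr leq_add2l occ_le_size.
Qed.

(** The two factors of [b] involved differ in length by at most 1: balance of [b] at equal length
    costs 1, the extra letter at most 1 more. *)
Lemma balanced_colour_const (T : eqType) (u : nat -> bool) (a0 : T) (b : nat -> T) :
  (forall k, b k != a0) -> balanced 1 u -> balanced 1 b ->
  balanced 2 (colour u (fun=> a0) b).
Proof.
move=> ba balu balb i j n x; rewrite -!/(occ _ _ _ _).
have [->|xa] := eqVneq x a0.
  rewrite !occ_colour_const //.
  by have := balu i j n false; rewrite -!/(occ _ _ _ _); lia.
rewrite !occ_colour //.
set Si := occ u true 0 i; set Sj := occ u true 0 j.
have hij := balu i j n true; have hji := balu j i n true.
rewrite -!/(occ _ _ _ _) in hij hji.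
move: (occ u true i n) (occ u true j n) hij hji => p q pq qp.
have := balb Si Sj q x; rewrite -!/(occ _ _ _ _).
have [le|lt] := leqP p q.
  by have := occ_mono b x Si le; lia.
by have := occ_mono b x Si (ltnW lt); lia.
Qed.

Lemma frequency_colour (R : realType) (T : eqType) (u : nat -> bool) (a0 : T)
    (b : nat -> T) x (alpha gamma : R) :
  x != a0 -> balanced 1 u -> frequency u true alpha ->
  balanced 1 b -> frequency b x gamma -> 0 < gamma < 1 ->
  frequency (colour u (fun=> a0) b) x (alpha * gamma).
Proof.
(* The constant 2 bounds [1 + gamma]: discrepancy 1 of [b], plus discrepancy 1 of [u] scaled by
   [gamma]. *)
move=> xa balu Hu balb Hb /andP[g0 g1]; apply: (@discrepancy_frequency _ _ _ _ _ 2) => n.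
rewrite occ_colour //.
have /ler_normlP[h1 h2] := balanced_discrepancy 0 n balu Hu.
have /ler_normlP[h3 h4] :=
  balanced_discrepancy (occ u true 0 0) (occ u true 0 n) balb Hb.
apply/ler_normlP; split; nra.
Qed.

Lemma frequency_two (R : realType) (T : eqType) (b : nat -> T) x y (f : R) :
  x != y -> (forall k, b k = x \/ b k = y) -> balanced 1 b -> frequency b y f ->
  frequency b x (1 - f).
Proof.
move=> xy H bal Hf; apply: (@discrepancy_frequency _ _ _ _ _ 1) => n.
have /ler_normlP[h1 h2] := balanced_discrepancy 0 n bal Hf.
have := occ_two 0 n xy H => /(congr1 (fun m => m%:R : R)); rewrite natrD => e.
apply/ler_normlP; split; lra.
Qed.

Lemma frequency_colour_const (R : realType) (T : eqType) (u : nat -> bool) (a0 : T)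
    (b : nat -> T) (f : R) :
  (forall k, b k != a0) -> frequency u false f ->
  frequency (colour u (fun=> a0) b) a0 f.
Proof.
move=> ba; rewrite /frequency.
suff -> : (fun n => (count_mem a0 (factor (colour u (fun=> a0) b) 0 n))%:R / n%:R : R) =
          (fun n => (count_mem false (factor u 0 n))%:R / n%:R : R) by [].
by apply: funext => n; rewrite -!/(occ _ _ _ _) occ_colour_const.
Qed.

(** Over two letters the positions of y determine the sequence, so a rational frequency would make
    it eventually periodic. *)
Lemma Sturmian_frequency_irrational (R : realType) (T : eqType) x y (b : nat -> T)
    (f : R) n m :
  Sturmian x y b -> frequency b y f -> (0 < n)%N -> n%:R * f != m%:R.
Proof.
move=> [xy [H [bal aper]]] Hf n0; apply/eqP => nf; apply: aper.
have [N HN] := balanced_rational_eventually bal Hf n0 nf.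
exists n, N; split=> // k Nk; have := HN k Nk.
by case: (H k) => ->; case: (H (k + n)%N) => ->; rewrite ?eqxx ?(negbTE xy).
Qed.

Lemma not_balanced_colour (R : realType) (T : eqType) (u : nat -> bool) (a0 x y : T)
    (b : nat -> T) (alpha gamma : R) :
  Sturmian false true u -> frequency u true alpha -> 0 < alpha < 1 ->
  a0 != x -> a0 != y -> Sturmian x y b -> frequency b y gamma -> 0 < gamma < 1 ->
  alpha * (1 + gamma) != 1 -> alpha * (2 - gamma) != 1 ->
  ~ balanced 1 (colour u (fun=> a0) b).
Proof.
move=> [_ [Hu2 [balu aperu]]] Hu /andP[al0 al1] ax ay Stb Hb g01 n1 n2 bal.
(* The inequality [2 * gamma != 1] separates the frequencies of x and y in the colouring. *)
have half := @Sturmian_frequency_irrational _ _ _ _ _ _ 2 1 Stb Hb isT.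
have [xy [Hxy [balb _]]] := Stb.
set v := colour _ _ _ in bal.
have ba k : b k != a0 by case: (Hxy k) => ->; rewrite eq_sym.
have Hf := frequency_two (isT : false != true) Hu2 balu Hu.
have F1 : frequency v a0 (1 - alpha) := frequency_colour_const ba Hf.
have F3 : frequency v y (alpha * gamma).
  by apply: frequency_colour => //; rewrite eq_sym.
have F2 : frequency v x (alpha * (1 - gamma)).
  apply: frequency_colour => //; [by rewrite eq_sym|exact: frequency_two Hb|].
  by move: g01; lra.
have tri k : [\/ v k = a0, v k = x | v k = y].
  by rewrite /v /colour; case: (u k); [case: (Hxy (occ u true 0 k)) => ->|]; constructor.
have aper : ~ eventually_periodic v.
  move=> [p [N [p0 HN]]]; apply: aperu; exists p, N; split=> // k Nk.
  (* The sequence [u] is read off from [v], so a period of [v] is one of [u]. *)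
  have uv m : u m = (v m != a0).
    by rewrite /v /colour; case: (u m); rewrite ?ba // eqxx.
  by rewrite !uv HN.
have [ax' ay' xy'] : [/\ a0 <> x, a0 <> y & x <> y] by split; apply/eqP.
have [xa' ya' yx'] : [/\ x <> a0, y <> a0 & y <> x] by split; exact: nesym.
have tri1 k : [\/ v k = a0, v k = y | v k = x] by case: (tri k); constructor.
have tri2 k : [\/ v k = x, v k = a0 | v k = y] by case: (tri k); constructor.
have tri3 k : [\/ v k = x, v k = y | v k = a0] by case: (tri k); constructor.
have tri4 k : [\/ v k = y, v k = a0 | v k = x] by case: (tri k); constructor.
have tri5 k : [\/ v k = y, v k = x | v k = a0] by case: (tri k); constructor.
move/andP: g01 => [g0 g1].
have p3 : 0 < alpha * gamma by nra.
have p2 : 0 < alpha * (1 - gamma) by nra.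
have d12 : 1 - alpha != alpha * (1 - gamma).
  by apply: contra n2 => /eqP e; apply/eqP; lra.
have d13 : 1 - alpha != alpha * gamma.
  by apply: contra n1 => /eqP e; apply/eqP; lra.
have d23 : alpha * (1 - gamma) != alpha * gamma.
  by apply: contra half => /eqP e; apply/eqP; apply: (mulfI (lt0r_neq0 al0)); lra.
apply: aper.
(* Two of the eight sign patterns are cyclic and contradictory; the other six are the orderings of
   the frequencies. *)
case: (ltgtP (1 - alpha) (alpha * (1 - gamma))) d12 => // c12 _;
case: (ltgtP (1 - alpha) (alpha * gamma)) d13 => // c13 _;
case: (ltgtP (alpha * (1 - gamma)) (alpha * gamma)) d23 => // c23 _; try by exfalso; lra.
- by apply: (balanced_ternary _ _ _ tri5 bal F3 F2 F1) => //; lra.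
- by apply: (balanced_ternary _ _ _ tri3 bal F2 F3 F1) => //; lra.
- by apply: (balanced_ternary _ _ _ tri2 bal F2 F1 F3) => //; lra.
- by apply: (balanced_ternary _ _ _ tri4 bal F3 F1 F2) => //; lra.
- by apply: (balanced_ternary _ _ _ tri1 bal F1 F3 F2) => //; lra.
- by apply: (balanced_ternary _ _ _ tri bal F1 F2 F3) => //; lra.
Qed.

(** * Complexity of balanced binary sequences *)

Lemma is_factor_factor T (v : nat -> T) i n : is_factor v (factor v i n).
Proof. by exists i; rewrite size_factor. Qed.

Lemma is_factor_prefix T (v : nat -> T) (s t : seq T) : is_factor v (s ++ t) -> is_factor v s.
Proof.
move=> [i]; rewrite size_cat factorD => e; exists i.
have := congr1 (take (size s)) e.
by rewrite take_size_cat // take_size_cat // size_factor.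
Qed.

Lemma is_factor_behead T (v : nat -> T) x (s : seq T) : is_factor v (x :: s) -> is_factor v s.
Proof. by move=> [i]; rewrite /= factorSl => -[_ e]; exists i.+1. Qed.

Lemma balanced_factors (T : eqType) C (v : nat -> T) x (s t : seq T) :
  balanced C v -> is_factor v s -> is_factor v t -> size s = size t ->
  (count_mem x s <= count_mem x t + C)%N.
Proof. by move=> bal [i es] [j et] st; rewrite es et st; exact: bal. Qed.

Lemma longest_common_prefix (T : eqType) (p q : seq T) : size p = size q -> p != q ->
  exists s c d p' q', [/\ c != d, p = s ++ c :: p' & q = s ++ d :: q'].
Proof.
elim: p q => [|c p IH] [|d q] //= [pq].
have [->|cd] := eqVneq c d.
  rewrite eqseq_cons eqxx /= => /(IH _ pq) [s [c' [d' [p' [q' [h -> ->]]]]]].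
  by exists (d :: s), c', d', p', q'.
by move=> _; exists [::], c, d, p, q.
Qed.

(* Two left special words p <> q of the same length would give factors x s x and
   y s y, where s is their longest common prefix. *)
Lemma left_special_unique (T : eqType) (x y : T) (v : nat -> T) (p q : seq T) :
  x != y -> (forall k, v k = x \/ v k = y) -> balanced 1 v -> size p = size q ->
  is_factor v (x :: p) -> is_factor v (y :: p) ->
  is_factor v (x :: q) -> is_factor v (y :: q) -> p = q.
Proof.
move=> xy H bal pq xp yp xq yq; apply/eqP; apply: contraT => npq.
have [s [c [d [p' [q' [cd ep eq]]]]]] := longest_common_prefix pq npq.
have letter w c' s' : is_factor v (w ++ c' :: s') -> c' = x \/ c' = y.
  move=> [i]; rewrite size_cat /= factorD => e.
  have := congr1 (drop (size w)) e.
  by rewrite !drop_size_cat ?size_factor // factorSl => -[-> _].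
have pre z w c' w' : z :: w ++ c' :: w' = (z :: rcons w c') ++ w'.
  by rewrite /= cat_rcons.
(* The word x s x has two more x's than y s y. *)
have contra : is_factor v (x :: rcons s x) -> is_factor v (y :: rcons s y) -> False.
  move=> h1 h2; have := balanced_factors x bal h1 h2.
  rewrite /= !size_rcons -!cats1 !count_cat /= !eqxx ![y == x]eq_sym (negbTE xy).
  by move=> /(_ erefl); lia.
subst p q.
have cl : c = x \/ c = y by apply: (letter (x :: s) _ p').
have dl : d = x \/ d = y by apply: (letter (x :: s) _ q').
rewrite !pre in xp yp xq yq.
move: xp yp xq yq => /is_factor_prefix xp /is_factor_prefix yp
  /is_factor_prefix xq /is_factor_prefix yq.
case: cl dl cd xp yp xq yq => -> [] ->; rewrite ?eqxx // => _ xp yp xq yq.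
  by case: (contra xp yq).
by case: (contra xq yp).
Qed.

(** Induction on [n] by deleting the first letter: two words collide only over a left special word,
    which is unique, so removing one word of [L] restores injectivity. *)
Lemma balanced_binary_complexity (T : eqType) (x y : T) (v : nat -> T) n (L : seq (seq T)) :
  x != y -> (forall k, v k = x \/ v k = y) -> balanced 1 v -> uniq L ->
  (forall w, w \in L -> is_factor v w /\ size w = n) -> (size L <= n.+1)%N.
Proof.
move=> xy H bal; elim: n L => [|n IH] L uL HL.
  suff : {subset L <= [:: [::]]} by move/(uniq_leq_size uL).
  by move=> w /HL[_ /size0nil ->]; rewrite mem_head.
have shape w : w \in L -> exists c p, [/\ w = c :: p, c = x \/ c = y, size p = n & is_factor v p].
  move=> /HL[fw]; case: w fw => //= c p fw [sp]; exists c, p; split=> //.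
    by case: fw => i; rewrite factorSl => -[-> _].
  exact: is_factor_behead fw.
have bound L' : uniq L' -> {subset L' <= L} -> {in L' &, injective behead} -> (size L' <= n.+1)%N.
  move=> uL' sub inj; rewrite -(size_map behead); apply: IH.
    by rewrite map_inj_in_uniq.
  by move=> w /mapP[w' /sub /shape[c [p [-> _ sp fp]]] ->].
have [[p [px py]]|none] := pselect (exists p, x :: p \in L /\ y :: p \in L); last first.
  apply: leqW; apply: bound => // w w' wL w'L.
  have [c [p [ew cl _ _]]] := shape _ wL; have [c' [p' [ew' cl' _ _]]] := shape _ w'L.
  move: wL w'L; rewrite ew ew' /= => wL w'L pp'; subst p'; congr (_ :: _).
  by case: cl cl' wL w'L => -> [] -> // h1 h2; case: none; exists p.
rewrite (perm_size (perm_to_rem px)) /= ltnS; apply: bound.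
- exact: rem_uniq.
- by move=> w /mem_rem.
move=> w w'; rewrite !mem_rem_uniq // !inE => /andP[nw wL] /andP[nw' w'L].
have [c [q [ew cl sq _]]] := shape _ wL; have [c' [q' [ew' cl' _ _]]] := shape _ w'L.
move: wL w'L nw nw'; rewrite ew ew' /= => wL w'L nw nw' qq'; subst q'; congr (_ :: _).
have sp : size p = size q by have [_ [->]] := HL _ px.
have special : x :: q \in L -> y :: q \in L -> p = q.
  move=> h1 h2; apply: (left_special_unique xy H bal sp).
  - by case: (HL _ px).
  - by case: (HL _ py).
  - by case: (HL _ h1).
  - by case: (HL _ h2).
case: cl cl' wL w'L nw nw' => -> [] -> // h1 h2 nw nw'.
  by move: nw; rewrite (special h1 h2) eqxx.
by move: nw'; rewrite (special h2 h1) eqxx.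
Qed.

(** * Abelian complexity of the colouring *)

Lemma balanced_two_values (T : eqType) (v : nat -> T) x n :
  balanced 1 v -> exists q, forall i, occ v x i n = q \/ occ v x i n = q.+1.
Proof.
move=> bal.
have ex : exists q, `[< exists i, occ v x i n = q >].
  by exists (occ v x 0 n); apply/asboolP; exists 0%N.
case: (ex_minnP ex) => q /asboolP[i0 eq] qmin; exists q => i.
have := qmin (occ v x i n) ltac:(by apply/asboolP; exists i).
by have := bal i i0 n x; rewrite -!/(occ _ _ _ _); lia.
Qed.

Lemma colour_parikh_le4 (u : nat -> bool) (b : nat -> nat) n :
  balanced 1 u -> balanced 1 b -> (forall k, b k = 2%N \/ b k = 3%N) ->
  has_at_most (fun p => exists w, is_factor (colour u (fun=> 1%N) b) w /\ size w = n /\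
                                   p = parikh [:: 1%N; 2%N; 3%N] w) 4.
Proof.
move=> balu balb Hb L uL HL.
have [q Hq] := balanced_two_values true n balu.
have [r Hr] := choice (fun m => balanced_two_values 3%N m balb).
(* Here [m] counts the letters other than 1 and [t] the 3's; for actual counts [t <= m <= n], so the
   truncated subtractions are exact. *)
pose vec m t := [:: n - m; m - t; t]%N.
have : {subset L <= [:: vec q (r q); vec q (r q).+1;
                        vec q.+1 (r q.+1); vec q.+1 (r q.+1).+1]}.
  move=> p /HL [w [[i ew] [sw ->]]]; rewrite {}ew sw.
  have -> : parikh [:: 1; 2; 3]%N (factor (colour u (fun=> 1%N) b) i n) =
      vec (occ u true i n) (occ b 3%N (occ u true 0 i) (occ u true i n)).
    rewrite /parikh /= -!/(occ _ _ _ _) /vec occ_colour_const; last first.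
      by move=> k; case: (Hb k) => ->.
    rewrite !occ_colour //; congr [:: _; _; _].
      by have := occ_false u i n; lia.
    by have := occ_two (occ u true 0 i) (occ u true i n) (isT : 2%N != 3%N) Hb; lia.
  case: (Hq i) => ->.
    by case: (Hr q (occ u true 0 i)) => ->; rewrite !inE eqxx ?orbT.
  by case: (Hr q.+1 (occ u true 0 i)) => ->; rewrite !inE eqxx ?orbT.
by move=> /(uniq_leq_size uL).
Qed.

(** * Factor complexity of the colouring *)

Lemma map_filter_inj (T : eqType) (a : T) (s t : seq T) :
  map (fun x => x != a) s = map (fun x => x != a) t ->
  seq.filter (fun x => x != a) s = seq.filter (fun x => x != a) t -> s = t.
Proof.
elim: s t => [|x s IH] [|y t] //= [xy /IH st].
have [ex|nx] := eqVneq x a.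
  by move: xy; rewrite ex eqxx => /esym/negbFE/eqP ->; rewrite eqxx => /st ->.
by rewrite nx in xy; rewrite -xy => -[-> /st ->].
Qed.

Lemma colour_factor_map (T : eqType) (u : nat -> bool) (a0 : T) (b : nat -> T) i n :
  (forall k, b k != a0) ->
  map (fun x => x != a0) (factor (colour u (fun=> a0) b) i n) = factor u i n.
Proof.
move=> ba; elim: n => [//|n IH].
rewrite !factorSr map_rcons IH /colour; congr rcons.
by case: (u _); rewrite ?ba ?eqxx.
Qed.

Lemma colour_factor_filter (T : eqType) (u : nat -> bool) (a0 : T) (b : nat -> T) i n :
  (forall k, b k != a0) ->
  seq.filter (fun x => x != a0) (factor (colour u (fun=> a0) b) i n) =
  factor b (occ u true 0 i) (occ u true i n).
Proof.
move=> ba; elim: n => [//|n IH].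
rewrite factorSr filter_rcons IH occS /colour; case: (u _) => /=.
  by rewrite ba addn1 factorSr -/(occ u true 0 _) occD.
by rewrite eqxx addn0.
Qed.

Lemma size_fibers (T S : eqType) (f : T -> S) (L : seq T) (U : seq S) :
  uniq U -> (forall w, w \in L -> f w \in U) ->
  size L = (\sum_(s <- U) count (fun w => f w == s) L)%N.
Proof.
move=> uU; elim: L => [|w L IH] H; first by rewrite big1.
rewrite /= big_split /= -IH; last by move=> w' h; apply: H; rewrite inE h orbT.
rewrite -add1n; congr (_ + _)%N.
rewrite (bigD1_seq (f w)) ?H ?mem_head //= eqxx big1 // => s.
by rewrite eq_sym => /negbTE ->.
Qed.

Lemma uniq_factors_le_card n (P : seq bool -> Prop) (U : seq (seq bool)) :
  uniq U -> (forall s, s \in U -> size s = n /\ P s) ->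
  (size U <= #|[set w : n.-tuple bool | `[< P w >] ]|)%N.
Proof.
move=> uU HU.
have su : size (pmap (insub : _ -> option (n.-tuple bool)) U) = size U.
  by rewrite size_pmap_sub; apply/eqP; rewrite -all_count; apply/allP => s /HU[/eqP].
rewrite -su -(card_uniqP (pmap_sub_uniq _ uU)).
apply: subset_leq_card; apply/fintype.subsetP => w.
rewrite mem_pmap_sub inE => wU; apply/asboolP.
by case: (HU _ wU).
Qed.

Lemma floor_compl (R : realType) (x : R) n : Num.floor (n%:R - x) = n%:Z - Num.ceil x.
Proof.
rewrite ceilNfloor opprK floorDzr ?natr_int //; congr (_ + _).
by apply: floor_def; rewrite intrD -!pmulrn lexx ltrDl ltr01.
Qed.

(** At fixed length [n] the count of b determines that of a, and [floor_compl] shows that the two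
    prescribed values add up to [n]. *)
Lemma P_alphaE (R : realType) (u : nat -> bool) (alpha : R) n K :
  Num.ceil (n%:R * alpha) = K%:Z ->
  P_alpha u alpha n =
  #|[set w : n.-tuple bool | `[< is_factor u w /\ count_mem true (w : seq bool) = K >] ]|.
Proof.
move=> eK; apply: eq_card => w; rewrite !inE; apply: asbool_equiv_eq.
rewrite mulrBl mul1r [alpha * _]mulrC floor_compl eK.
have := count_predC (pred1 true) w; rewrite size_tuple.
have -> : count (predC (pred1 true)) w = count_mem false w by apply: eq_count => -[].
move=> e; split=> [/asboolP[fw [_ [h]]] //|[fw h]].
apply/asboolP; rewrite h; split=> //; split=> //;
have -> : n%:Z = (K + count_mem false w)%N by rewrite -h e.
by rewrite PoszD addrC addKr.
Qed.

Lemma colour_complexity (R : realType) (T : eqType) (u : nat -> bool) (a0 x y : T)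
    (b : nat -> T) (alpha : R) n :
  Sturmian false true u -> frequency u true alpha -> 0 < alpha ->
  a0 != x -> a0 != y -> Sturmian x y b -> (0 < n)%N ->
  has_at_most (fun w => is_factor (colour u (fun=> a0) b) w /\ size w = n)
              ((P_alpha u alpha n)%:Z + (n.+1)%:Z * Num.ceil (n%:R * alpha)).
Proof.
move=> Stu Hu al0 ax ay [xy [Hb [balb _]]] n0 L uL HL.
have [_ [Hu2 [balu _]]] := Stu.
have ba k : b k != a0 by case: (Hb k) => ->; rewrite eq_sym.
have [K eK] : exists K : nat, Num.ceil (n%:R * alpha) = K%:Z.
  exists `|Num.ceil (n%:R * alpha)|%N; rewrite gez0_abs // -(ler_int R).
  by apply: le_trans (ceil_ge _); rewrite mulr_ge0 // ltW.
(* Discrepancy gives a count of at most [n * alpha + 1]; irrationality makes this strict, so the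
   count minus one is below [K]. *)
have occK i : (occ u true i n <= K)%N.
  have /ler_normlP[_ h] := balanced_discrepancy i n balu Hu.
  have ge := ceil_ge (n%:R * alpha); rewrite eK in ge.
  case: (posnP (occ u true i n)) => [->//|o0].
  have ne := @Sturmian_frequency_irrational _ _ _ _ _ _ n (occ u true i n).-1 Stu Hu n0.
  rewrite -(prednK o0) -(ltr_nat R); rewrite -(prednK o0) -natr1 in h.
  apply: lt_le_trans ge; rewrite lt_neqAle eq_sym ne; lra.
rewrite (P_alphaE u eK) eK -PoszM -PoszD lez_nat.
pose f w := map (fun z : T => z != a0) w.
pose U := undup (map f L).
have HU s : s \in U -> exists i, s = factor u i n.
  rewrite mem_undup => /mapP[w /HL [[i ew] sw] ->]; exists i.
  by rewrite ew sw /f colour_factor_map.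
have UK s : s \in U -> (count_mem true s <= K)%N.
  by move=> /HU[i ->]; apply: occK.
rewrite (@size_fibers _ _ f L U) ?undup_uniq //; last first.
  by move=> w wL; rewrite mem_undup map_f.
(* A word over [s] is recovered from [s] and its letters other than [a0], which form a factor of [b]
   whose length is the number of b's in [s]. *)
have fiber s : s \in U -> (count (fun w => f w == s) L <= (count_mem true s).+1)%N.
  move=> sU; rewrite -size_filter -(size_map (seq.filter (fun z => z != a0))).
  apply: (balanced_binary_complexity xy Hb balb).
    rewrite map_inj_in_uniq ?filter_uniq // => w w'.
    rewrite !mem_filter => /andP[/eqP e _] /andP[/eqP e' _]; apply: map_filter_inj.
    by rewrite -/(f w) -/(f w') e e'.
  move=> z /mapP[w]; rewrite mem_filter => /andP[/eqP <- /HL[[i ew] sw]] ->.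
  rewrite ew sw /f colour_factor_map // colour_factor_filter // size_factor.
  by split=> //; apply: is_factor_factor.
(* A count [m <= K] satisfies [m + 1 <= K], except that [m = K] costs one more. The exceptional
   words are those counted by [P_alpha], and the constant [K] is summed over at most [n + 1]
   words. *)
have sz : (\sum_(s <- U) count (fun w => f w == s) L <=
           \sum_(s <- U) (K + (count_mem true s == K)))%N.
  rewrite !big_seq; apply: leq_sum => s sU.
  by have := fiber s sU; have := UK s sU; case: eqP; lia.
apply: leq_trans sz _; rewrite big_split /= addnC leq_add //.
  have -> : (\sum_(s <- U) (count_mem true s == K) = count (fun s => count_mem true s == K) U)%N.
    by rewrite -sum1_count [RHS]big_mkcond.
  rewrite -size_filter; 
  apply: (@uniq_factors_le_card n (fun s => is_factor u s /\ count_mem true s = K)).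
    by rewrite filter_uniq ?undup_uniq.
  move=> s; rewrite mem_filter => /andP[/eqP sK /HU[i es]].
  by rewrite es size_factor -es; split=> //; split=> //; rewrite es; apply: is_factor_factor.
rewrite big_const_seq iter_addn_0 mulnC leq_mul2r count_predT orbC.
rewrite (balanced_binary_complexity (isT : false != true) Hu2 balu) ?undup_uniq //.
by move=> s /HU[i ->]; rewrite size_factor; split=> //; apply: is_factor_factor.
Qed.

Theorem theorem2 (R : realType) (u : nat -> bool) (bseq : nat -> nat) (alpha gamma : R) :
  Sturmian false true u -> frequency u true alpha ->
  0 < alpha < 1 -> irrational alpha ->
  Sturmian 2%N 3%N bseq -> frequency bseq 3%N gamma -> 0 < gamma < 1 ->
  let v := colour u (fun _ => 1%N) bseq in
  (balanced 2 v /\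
   (alpha != 1 / (1 + gamma) -> alpha != 1 / (2 - gamma) -> ~ balanced 1 v)) /\
  (forall n : nat, (1 <= n)%N ->
     has_at_most (fun w : seq nat => is_factor v w /\ size w = n)
             ((P_alpha u alpha n)%:Z + (n.+1)%:Z * Num.ceil (n%:R * alpha)) /\
     has_at_most (fun p : seq nat => exists w, is_factor v w /\ size w = n /\
                                   p = parikh [:: 1%N; 2%N; 3%N] w) 4).
Proof.
move=> Stu Hu a01 _ Stb Hb g01 v.
have [/andP[a0 a1] /andP[g0 g1]] := (a01, g01).
have [[_ [_ [balu _]]] [_ [b23 [balb _]]]] := (Stu, Stb).
split; [split|].
- by apply: balanced_colour_const => // k; case: (b23 k) => ->.
- move=> n1 n2; apply: (not_balanced_colour Stu Hu a01 _ _ Stb Hb g01) => //.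
    by apply: contra n1 => /eqP e; apply/eqP/(canRL (mulfK _) e); rewrite lt0r_neq0 // addr_gt0.
  have g2 : 0 < 2 - gamma by lra.
  by apply: contra n2 => /eqP e; apply/eqP/(canRL (mulfK _) e); rewrite lt0r_neq0.
move=> n n0; split; last exact: colour_parikh_le4.
exact: (colour_complexity Stu Hu a0 _ _ Stb n0).
Qed.
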